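(* Let $n\ge 1$ be an integer and let $H^+_n=\langle a,b,c \mid b(ab)^nba=cb(ab)^nb,\ ab=bc,\ ac=ca\rangle_{mo}$, with $\deg$ the word length. Its skew growth function is $$N_{H^{+}_n,\deg}(t)=(1-t)\,(t^{2n+5}+t^{2n+4}+t^{2n+3}-2t+1).$$
   Context: $\langle L\mid R\rangle_{mo}$ denotes the monoid presented by a finite set of generators $L$ and relations $R$, i.e. the quotient of the free monoid $L^*$ by the congruence generated by $R$. All relations equate words of equal length, so the length of words gives a well-defined homomorphism $\deg:M\to\mathbb{Z}_{\ge 0}$. The monoid considered here is cancellative. Let $M=\langle L\mid R\rangle_{mo}$ be such a monoid. For $u,v\in M$ write $u|_l v$ if $v=ux$ for some $x\in M$. For a subset $J\subset M$ put $\mathrm{cm}_r(J)=\{u\in M: j|_l u \text{ for all } j\in J\}$, $\mathrm{min}_r(J)=\{u\in J: \text{every } v\in J \text{ with } v|_l u \text{ equals } u\}$, and $\mathrm{mcm}(J)=\mathrm{min}_r(\mathrm{cm}_r(J))$. A tower of $M$ of height $p\in\mathbb{Z}_{\ge0}$ is a sequence $T=(I_0,J_1,\dots,J_p)$ of subsets of $M$, where $I_0$ is the image of $L$ in $M$, such that, putting $I_k:=\mathrm{mcm}(J_k)$, for each $k=1,\dots,p$ one has $J_k\subset I_{k-1}$, $1<\#J_k<\infty$ and $I_k\neq\emptyset$. Put $|T|:=I_p$. $\mathrm{Tmcm}(M)$ is the set of all towers (including the height-$0$ tower $(I_0)$). The skew growth function is the formal power series $$N_{M,\deg}(t)=1+\sum_{T=(I_0,J_1,\dots,J_p)\in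 \mathrm{Tmcm}(M)}(-1)^{\#J_1+\cdots+\#J_p-p+1}\sum_{\Delta\in|T|}t^{\deg(\Delta)}.$$ *)

(* Defs.v *)
From HB Require Import structures.
From mathcomp Require Import all_boot all_order all_algebra finmap generic_quotient.
From mathcomp Require Import boolp classical_sets functions cardinality fsbigop.

Set Implicit Arguments.
Unset Strict Implicit.
Unset Printing Implicit Defensive.

Import GRing.Theory.

Local Open Scope classical_set_scope.
Local Open Scope ring_scope.
Local Open Scope quotient_scope.

Section PresentedMonoid.
Variables (L : finType) (R : seq (seq L * seq L)).

Inductive cong : seq L -> seq L -> Prop :=
| cong_rel u v : (u, v) \in R -> cong u v
| cong_refl u : cong u u
| cong_sym u v : cong u v -> cong v u
| cong_trans u v w : cong u v -> cong v w -> cong u w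
| cong_cat u u' v v' : cong u u' -> cong v v' -> cong (u ++ v) (u' ++ v').

Definition congb (u v : seq L) : bool := `[< cong u v >].

Lemma congb_refl : reflexive congb.
Proof. by move=> u; apply/asboolP; exact: cong_refl. Qed.

Lemma congb_sym : symmetric congb.
Proof. by move=> u v; apply/asboolP/asboolP; exact: cong_sym. Qed.

Lemma congb_trans : transitive congb.
Proof.
by move=> v u w /asboolP uv /asboolP vw; apply/asboolP; exact: cong_trans vw.
Qed.

Canonical cong_equiv := EquivRel congb congb_refl congb_sym congb_trans.

Definition pres_monoid := {eq_quot cong_equiv}.
HB.instance Definition _ := Choice.on pres_monoid.
HB.instance Definition _ := EqQuotient.on pres_monoid.

Definition word_class (w : seq L) : pres_monoid := \pi w.

Lemma word_classP u v : word_class u = word_class v <-> cong u v.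
Proof.
split=> [/eqquotP/asboolP //|uv]; apply/eqquotP; exact/asboolP.
Qed.

Lemma cong_repr w : cong (repr (word_class w)) w.
Proof. by apply/word_classP; rewrite /word_class reprK. Qed.

Definition pres_one : pres_monoid := word_class [::].
Definition pres_mul (x y : pres_monoid) : pres_monoid :=
  word_class (repr x ++ repr y).

Lemma word_class_cat u v :
  word_class (u ++ v) = pres_mul (word_class u) (word_class v).
Proof. by apply/word_classP/cong_sym/cong_cat; exact: cong_repr. Qed.

Lemma word_class_repr x : word_class (repr x) = x.
Proof. exact: reprK. Qed.

Lemma pres_mulA : associative pres_mul.
Proof.
move=> x y z; rewrite -(word_class_repr x) -(word_class_repr y).
by rewrite -(word_class_repr z) -!word_class_cat catA.
Qed.

Lemma pres_mul1 : left_id pres_one pres_mul.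
Proof. by move=> x; rewrite -(word_class_repr x) -word_class_cat. Qed.

Lemma pres_mulr1 : right_id pres_one pres_mul.
Proof. by move=> x; rewrite -(word_class_repr x) -word_class_cat cats0. Qed.

HB.instance Definition _ :=
  isMonoid.Build pres_monoid pres_mulA pres_mul1 pres_mulr1.

Definition generators : set pres_monoid :=
  range (fun l : L => word_class [:: l]).

(* Meaningful for homogeneous presentations only: the value then does not
   depend on the representative (deg_word_class), and deg is additive (degM). *)
Definition deg (x : pres_monoid) : nat := size (repr x).

Definition homogeneous := {in R, forall r, size r.1 = size r.2}.

Lemma cong_size u v : homogeneous -> cong u v -> size u = size v.
Proof.
move=> hR; elim=> {u v} [u v /hR //|//|//|u v w _ -> _ ->//|].
by move=> u u' v v' _ hu _ hv; rewrite !size_cat hu hv.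
Qed.

Lemma deg_word_class w : homogeneous -> deg (word_class w) = size w.
Proof. by move=> /cong_size; apply; exact: cong_repr. Qed.

Lemma degM (x y : pres_monoid) :
  homogeneous -> deg (x * y)%g = (deg x + deg y)%N.
Proof. by move=> hR; rewrite deg_word_class ?size_cat. Qed.

End PresentedMonoid.

Arguments generators {L} R _.
Arguments deg {L} R x.

Section SkewGrowth.
Variables (M : monoidType) (I0 : set M) (deg : M -> nat).

Definition ldiv (u v : M) : Prop := exists x : M, v = (u * x)%g.

Definition cm_r (J : set M) : set M :=
  [set u | forall j, J j -> ldiv j u].

Definition min_r (J : set M) : set M :=
  [set u | J u /\ forall v, J v -> ldiv v u -> v = u].

Definition mcm (J : set M) : set M := min_r (cm_r J).

(* The tower (I_0, J_1, ..., J_p) is encoded by the list [:: J_1; ...; J_p],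
   the set I_0 being fixed; J_k is the entry of index k - 1 and the finiteness
   of J_k is carried by its type. *)
Definition level (T : seq {fset M}) (k : nat) : set M :=
  if k is k'.+1 then mcm [set` nth fset0 T k'] else I0.

Definition is_tower (T : seq {fset M}) : Prop :=
  forall k, (k < size T)%N ->
    [/\ [set` nth fset0 T k] `<=` level T k,
        (1 < #|` nth fset0 T k|)%N
      & level T k.+1 !=set0].

Definition tower_top (T : seq {fset M}) : set M := level T (size T).

Definition Tmcm : set (seq {fset M}) := [set T | is_tower T].

(* A formal power series is given by its sequence of coefficients; this is the
   sum of the monomials t^(deg x) for x in A. *)
Definition deg_series (A : set M) : nat -> int :=
  fun d => \sum_(x \in A) (deg x == d)%:Z.

(* In both sums only finitely many terms contribute to a given coefficient when
   M is generated by a finite set I0 of elements of degree 1 and deg is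
   additive: degrees strictly increase along a tower, and each J_k consists of
   left divisors of any element of the top.  The subtraction in the exponent
   never truncates, since each J_k has at least two elements. *)
Definition skew_growth : nat -> int := fun d =>
  (d == 0%N)%:Z +
  \sum_(T \in Tmcm)
     (-1) ^+ ((\sum_(J <- T) #|` J|) - size T + 1)%N
     * deg_series (tower_top T) d.

End SkewGrowth.

Definition poly_series (p : {poly int}) : nat -> int := fun d => p`_d.

Section Hn.
Variable n : nat.

Let a : 'I_3 := @Ordinal 3 0 isT.
Let b : 'I_3 := @Ordinal 3 1 isT.
Let c : 'I_3 := @Ordinal 3 2 isT.
Let abn : seq 'I_3 := flatten (nseq n [:: a; b]).

Definition Hn_rel : seq (seq 'I_3 * seq 'I_3) :=
  [:: ([:: b] ++ abn ++ [:: b; a], [:: c; b] ++ abn ++ [:: b]);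
      ([:: a; b], [:: b; c]);
      ([:: a; c], [:: c; a])].

Definition Hn : monoidType := pres_monoid Hn_rel.

Lemma Hn_rel_homogeneous : homogeneous Hn_rel.
Proof.
move=> r; rewrite !inE => /or3P[] /eqP-> //=.
by rewrite !size_cat /= !addnS !addn0.
Qed.

End Hn.

(* Main.v *)
Require Import Defs.
From mathcomp Require Import all_boot all_order all_algebra finmap.
From mathcomp Require Import boolp classical_sets functions cardinality fsbigop.
From mathcomp Require Import zify ring.

(* The coefficients of the skew growth function are determined by divisibility.
   Let W(x) be the signed number of towers T with x in |T|, plus 1 if x = 1.
   Splitting off J_1 and using that the sum of (-1)^#J over the subsets J of a
   nonempty finite set vanishes, the sum of W(x) over the left divisors x of m
   is 1 if m = 1 and 0 otherwise. By Moebius inversion any other function with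
   this property equals W, so it suffices to find one for H_n^+.

   With B = (cb)^n the relations say that, for m <> 1,
     [a] + [b] + [c] - [ac] - [ab] - [bbBa] + [bbBacba] = 1,
   where [u] is 1 if u left-divides m and 0 otherwise. This rests on: a common
   multiple of a and c (of a and b) is a multiple of ac (of ab); a common
   multiple of b and c which a does not divide is a multiple of bbBa; and a
   multiple of bbBa which a divides is a multiple of bbBacba.

   To decide equality, write each element as c^k a^j or c^k b g. The relations
   ab = bc and ac = ca move letters to the left, and the remaining one becomes
   c^k b h = c^(k+1) b h' for h = c^s bBau, h' = c^s bBu. By induction on the
   degree h -> h' is a well-defined partial injection, which yields left
   cancellation and the divisibility statements. *)

Set Implicit Arguments.
Unset Strict Implicit.
Unset Printing Implicit Defensive.

Import GRing.Theory.

(** * Skew growth and left divisibility *)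

Section AlternatingSum.
Local Open Scope fset_scope.
Local Open Scope classical_set_scope.
Local Open Scope ring_scope.
Variable K : choiceType.

(** Toggling a fixed element [x] pairs the subsets of [S] with opposite signs. *)
Lemma sum_fpowerset_sign (S : {fset K}) :
  \sum_(J <- fpowerset S) (-1) ^+ #|` J| = (S == fset0)%:Z :> int.
Proof.
have [->|[x xS]] := fset_0Vmem S; first by rewrite fpowerset0 big_seq_fset1 cardfs0 eqxx.
have -> : (S == fset0) = false by apply/negP => /eqP S0; rewrite S0 inE in xS.
rewrite (bigID (fun J : {fset K} => x \in J)) /= -[X in X + _]big_filter.
rewrite (perm_big [seq (x |` J)%fset | J : {fset K} <-
    [seq J : {fset K} <- fpowerset S | x \notin J]]) /=; last first.
  apply: uniq_perm; first by rewrite filter_uniq ?fset_uniq.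
    rewrite map_inj_in_uniq ?filter_uniq ?fset_uniq // => J J'.
    rewrite !mem_filter => /andP[xJ _] /andP[xJ' _] /(congr1 (fun X => X `\ x)%fset).
    by rewrite !fsetU1K.
  move=> J; rewrite mem_filter; apply/andP/mapP => [[xJ JS]|[J' + ->]].
    exists (J `\ x)%fset; last by rewrite fsetD1K.
    rewrite mem_filter !inE eqxx /= fpowersetE; move: JS; rewrite fpowersetE.
    exact/fsubset_trans/fsubD1set.
  rewrite mem_filter fpowersetE => /andP[xJ' JS]; split; first by rewrite !inE eqxx.
  by rewrite fpowersetE fsubUset fsub1set xS.
rewrite big_map big_filter -big_split big1 //= => J xJ.
by rewrite cardfsU1 xJ exprS mulN1r addNr.
Qed.

(** The empty set and the singletons, contributing 1 and -#S, are removed from the previous sum. *)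
Lemma sum_fpowerset_sign_gt1 (S : {fset K}) :
  \sum_(J <- fpowerset S | (1 < #|` J|)%N) (-1) ^+ #|` J| =
  (#|` S|)%:Z - (S != fset0)%:Z :> int.
Proof.
have := sum_fpowerset_sign S; rewrite (bigID (fun J : {fset K} => 1 < #|` J|)%N) /=.
rewrite -[X in _ + X = _]big_filter.
rewrite [X in _ + X = _](perm_big (fset0 :: [seq [fset x]%fset | x <- S])) /=; last first.
  apply: uniq_perm; first by rewrite filter_uniq ?fset_uniq.
    rewrite /= map_inj_uniq ?fset_uniq ?andbT; last exact: fset1_inj.
    by apply/mapP => -[x _ /fsetP/(_ x)]; rewrite !inE eqxx.
  move=> J; rewrite mem_filter fpowersetE inE; apply/andP/orP.
    move=> [J1 JS]; have [->|J0] := eqVneq J fset0; [by left | right].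
    have /cardfs1P[x ex] : #|` J| == 1%N.
      by rewrite eqn_leq leqNgt J1 cardfs_gt0.
    by apply/mapP; exists x => //; rewrite -fsub1set -ex.
  move=> [/eqP->|/mapP[x xS ->]]; first by rewrite cardfs0 fsub0set.
  by rewrite cardfs1 fsub1set.
rewrite big_cons big_map cardfs0 expr0.
have -> : \sum_(x <- S) (-1) ^+ #|` [fset x]%fset| = - (#|` S|)%:Z :> int.
  under eq_bigr do rewrite cardfs1 expr1.
  by rewrite sumrN big_const_seq count_predT iter_addr addr0 natz.
by move: (\sum_(_ <- _ | _) _) => s; case: eqP => _ /=; lia.
Qed.

Lemma sum_fset_eq (S : {fset K}) (P : pred K) e : e \in S ->
  \sum_(x <- S | P x) (x == e)%:Z = (P e)%:Z.
Proof.
move=> eS; rewrite big_mkcond (bigD1_seq e) //= eqxx big1 ?addr0; first by case: (P e).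
by move=> x /negPf ->; case: (P x).
Qed.

End AlternatingSum.

Section Towers.
Local Open Scope fset_scope.
Local Open Scope classical_set_scope.
Local Open Scope ring_scope.
Variables (M : monoidType) (deg : M -> nat).

Lemma ldiv_refl (x : M) : ldiv x x. Proof. by exists 1%g; rewrite mulg1. Qed.

Lemma ldiv_trans (x y z : M) : ldiv x y -> ldiv y z -> ldiv x z.
Proof. by move=> [u ->] [v ->]; exists (u * v)%g; rewrite mulgA. Qed.

Lemma level_cons (A : set M) J T k :
  level A (J :: T) k.+1 = level (mcm [set` J]) T k.
Proof. by case: k. Qed.

Lemma is_tower_cons (A : set M) J T : is_tower A (J :: T) <->
  [/\ [set` J] `<=` A, (1 < #|` J|)%N, mcm [set` J] !=set0
    & is_tower (mcm [set` J]) T].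
Proof.
split=> [tJ|[JA J1 J0 tT] [|k] kT].
- have [JA J1 J0] := tJ 0%N isT; split=> // k kT.
  by have := tJ k.+1 kT; rewrite !level_cons.
- by [].
- by have := tT k kT; rewrite !level_cons.
Qed.

Lemma tower_top_cons (A : set M) J T :
  tower_top A (J :: T) = tower_top (mcm [set` J]) T.
Proof. exact: level_cons. Qed.

(** Product form of the sign, multiplicative in the first entry and free of truncated
    subtraction. *)
Definition tower_sign (T : seq {fset M}) : int :=
  - \prod_(J <- T) - (-1) ^+ #|` J|.

Lemma tower_sign_nil : tower_sign [::] = -1.
Proof. by rewrite /tower_sign big_nil. Qed.

Lemma tower_sign_cons J T :
  tower_sign (J :: T) = - (-1) ^+ #|` J| * tower_sign T.
Proof. by rewrite /tower_sign big_cons mulrN. Qed.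

Lemma tower_signE (A : set M) T : is_tower A T ->
  (-1) ^+ ((\sum_(J <- T) #|` J|) - size T + 1)%N = tower_sign T.
Proof.
have sub_size (B : set M) S : is_tower B S -> (size S <= \sum_(J <- S) #|` J|)%N.
  elim: S B => // J S IH B /is_tower_cons[_ J1 _ /IH sS]; rewrite big_cons /= -(add1n (size S)).
  by apply: leq_add sS; apply: ltnW.
elim: T A => [|J T IH] A; first by rewrite /tower_sign !big_nil.
move=> /is_tower_cons[_ J1 _ tT]; rewrite tower_sign_cons -(IH _ tT) big_cons /=.
rewrite mulNr -exprD -[in RHS]mulN1r -exprS.
have := sub_size _ _ tT; set s := (\sum_(_ <- _) _)%N => sT.
have -> : (#|` J| + (s - size T + 1)).+1%N = (#|` J| + s - (size T).+1 + 1).+2%N by lia.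
by rewrite !exprS !mulrA mulN1r opprK mul1r.
Qed.

Hypothesis degM : forall x y, deg (x * y)%g = (deg x + deg y)%N.
Hypothesis deg_eq0 : forall x, deg x = 0%N -> x = 1%g.

Lemma deg_ldiv x y : ldiv x y -> (deg x <= deg y)%N.
Proof. by move=> [u ->]; rewrite degM leq_addr. Qed.

Lemma ldiv_deg_eq x y : ldiv x y -> (deg y <= deg x)%N -> x = y.
Proof.
by move=> [u ->]; rewrite degM => ?; rewrite (deg_eq0 (x := u)) ?mulg1; last lia.
Qed.

(** A common multiple of smaller degree dividing [m] allows descent; if there is none, [m] itself is
    minimal. *)
Lemma mcm_below (J : set M) m : (forall j, J j -> ldiv j m) ->
  exists2 x, mcm J x & ldiv x m.
Proof.
move=> Jm; have [k km] := ubnP (deg m).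
elim: k m km Jm => // k IH m km Jm.
have [[x [cx xm lt_xm]]|nx] :=
  pselect (exists x, [/\ cm_r J x, ldiv x m & (deg x < deg m)%N]).
  have [||y my yx] := IH x => //; first by lia.
  by exists y => //; apply: ldiv_trans yx xm.
exists m; last exact: ldiv_refl.
split=> // v cv vm; apply: ldiv_deg_eq => //; rewrite leqNgt.
by apply/negP => lt_vm; apply: nx; exists v.
Qed.

(** Otherwise each [j] divides [x] and has degree at least that of [x], hence equals [x], and [J]
    has at most one element. *)
Lemma mcm_deg (J : {fset M}) e x : (1 < #|` J|)%N ->
  (forall j, j \in J -> (e <= deg j)%N) -> mcm [set` J] x -> (e < deg x)%N.
Proof.
move=> J1 Je [cx _]; rewrite ltnNge; apply/negP => xe.
suff : (#|` J| <= #|` [fset x]|)%N by rewrite cardfs1 leqNgt J1.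
apply/fsubset_leq_card/fsubsetP => j jJ; rewrite inE; apply/eqP.
by apply: ldiv_deg_eq; [exact: cx | exact: leq_trans xe (Je _ jJ)].
Qed.

Lemma tower_top_ldiv (A : set M) T x j : is_tower A T -> tower_top A T x ->
  (forall y, A y -> ldiv j y) -> ldiv j x.
Proof.
elim: T A => [|K T IH] A; first by move=> _ Ax; apply.
move=> /is_tower_cons[KA K1 _ tT]; rewrite tower_top_cons => Tx jA.
apply: IH tT Tx _ => y [cy _].
have [k kK] : exists k, k \in K by apply/fset0Pn; rewrite -cardfs_gt0 ltnW.
exact: ldiv_trans (jA _ (KA _ kK)) (cy _ kK).
Qed.

(** Each level raises the degree by at least one, so the degree of a top element bounds the
    height. *)
Lemma tower_top_deg (A : set M) T x e : is_tower A T -> tower_top A T x ->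
  (forall y, A y -> (e <= deg y)%N) -> (e + size T <= deg x)%N.
Proof.
elim: T A e => [|K T IH] A e; first by move=> _ Ax; rewrite addn0; apply.
move=> /is_tower_cons[KA K1 _ tT]; rewrite tower_top_cons => Tx eA.
rewrite /= addnS -addSn; apply: IH tT Tx _ => y; apply: mcm_deg => //.
by move=> j jK; apply/eA/KA.
Qed.

(** * Towers contributing up to degree [d], and Moebius inversion *)

Section BoundedDegree.
Variables (d : nat) (U : {fset M}).
Hypothesis inU : forall x, (x \in U) = (deg x <= d)%N.

Definition tower_step (A : set M) (J : {fset M}) : bool :=
  `[< [/\ [set` J] `<=` A, (1 < #|` J|)%N & mcm [set` J] !=set0] >].

Fixpoint towers f (A : set M) : seq (seq {fset M}) :=
  if f is f'.+1 then
    [::] :: [seq J :: T | J <- [seq J : {fset M} <- fpowerset U | tower_step A J],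
                          T <- towers f' (mcm [set` J])]
  else [:: [::]].

Lemma mem_towersS f A T : T \in towers f.+1 A <->
  T = [::] \/ exists J S, [/\ J \in fpowerset U, tower_step A J,
    S \in towers f (mcm [set` J]) & T = J :: S].
Proof.
rewrite inE; split=> [/predU1P[->|]|[->|[J [S [JU AJ TS ->]]]]]; [by left| | |].
- move=> /(allpairsPdep (S := {fset M}) (T := fun=> seq {fset M}))[J [S [+ TS ->]]].
  by rewrite mem_filter => /andP[AJ JU]; right; exists J, S.
- by rewrite eqxx.
- apply/orP; right.
  apply/(allpairsPdep (S := {fset M}) (T := fun=> seq {fset M})); exists J, S.
  by rewrite mem_filter AJ.
Qed.

Lemma towers_uniq f A : uniq (towers f A).
Proof.
elim: f A => // f IH A /=; apply/andP; split.
  apply/negP => /(allpairsPdep (S := {fset M}) (T := fun=> seq {fset M})).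
  by move=> [J [S []]].
apply: (allpairs_uniq_dep (S := {fset M}) (T := fun=> seq {fset M})).
- by rewrite filter_uniq ?fset_uniq.
- by move=> J _; apply: IH.
- by move=> [J T] [J' T'] _ _ /= [-> ->].
Qed.

Lemma towersP f A T : T \in towers f A -> is_tower A T.
Proof.
elim: f A T => [|f IH] A T; first by rewrite inE => /eqP ->.
move=> /mem_towersS[-> //|[J [S [_ /asboolP[JA J1 J0] /IH tS ->]]]].
exact/is_tower_cons.
Qed.

(** Elements of an entry divide [x], hence lie in [U]; the height is at most [d - e], hence within
    the fuel. *)
Lemma mem_towers f A T e x : (d <= e + f)%N -> (forall y, A y -> (e <= deg y)%N) ->
  is_tower A T -> tower_top A T x -> (deg x <= d)%N -> T \in towers f A.
Proof.
elim: f A T e => [|f IH] A T e def Ae tT Tx xd.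
  have := tower_top_deg tT Tx Ae; case: T {tT Tx} => //= J T; lia.
apply/mem_towersS; case: T tT Tx => [|J T] tT Tx; [by left | right; exists J, T].
have /is_tower_cons[JA J1 J0 tT'] := tT; rewrite tower_top_cons in Tx.
split=> //; first last.
- apply: (IH _ _ e.+1) => //; first by rewrite addSnnS.
  by move=> y; apply: mcm_deg => // j /JA; apply: Ae.
- exact/asboolP.
rewrite fpowersetE; apply/fsubsetP => j jJ; rewrite inU; apply: leq_trans xd.
by apply/deg_ldiv/(tower_top_ldiv tT' Tx) => y [cy _]; apply: cy.
Qed.

Definition below (A : set M) m : {fset M} := [fset x in U | `[< A x /\ ldiv x m >]].

Lemma in_below A m x : (deg m <= d)%N -> (x \in below A m) = `[< A x /\ ldiv x m >].
Proof.
move=> md; rewrite !inE /= inU; case: asboolP => [[_ /deg_ldiv xm]|]; rewrite ?andbF ?andbT //.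
exact: leq_trans xm md.
Qed.

(** By induction the towers with first entry [J] contribute (-1)^#J exactly when [m] is a common
    multiple of [J], that is, when [J] is a subset of [below A m]. Summed over these [J] this
    cancels the cardinality coming from the empty tower, up to the indicator. *)
Lemma sum_tower_sign f A m e : (d <= e + f)%N ->
  (forall y, A y -> (e <= deg y)%N) -> (deg m <= d)%N ->
  \sum_(T <- towers f A) tower_sign T * (#|` below (tower_top A T) m|)%:Z =
  - (below A m != fset0)%:Z.
Proof.
elim: f A e => [|f IH] A e def Ae md.
  (* Without fuel [e] is at least [d], so only [m] itself can lie in [A] and divide [m]. *)
  rewrite big_seq1 tower_sign_nil mulN1r; congr (- _).
  rewrite -cardfs_gt0; suff : (#|` below A m| <= 1)%N by case: #|` _| => [|[]].
  rewrite -(cardfs1 m); apply/fsubset_leq_card/fsubsetP => x.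
  rewrite in_below // => /asboolP[Ax xm]; rewrite inE; apply/eqP/ldiv_deg_eq => //.
  by apply: leq_trans md (leq_trans def _); rewrite addn0; apply: Ae.
rewrite /= big_cons tower_sign_nil mulN1r big_allpairs_dep big_filter.
rewrite (_ : \sum_(J <- _ | _) _ =
  \sum_(J <- fpowerset U | tower_step A J)
    (-1) ^+ #|` J| * (below (mcm [set` J]) m != fset0)%:Z); last first.
  apply: eq_bigr => J /asboolP[JA J1 _].
  under eq_bigr do rewrite tower_sign_cons tower_top_cons -mulrA.
  rewrite -big_distrr /= (IH _ e.+1) ?mulrNN ?mulNr ?mulrN ?opprK //; first by rewrite addSnnS.
  by move=> y; apply: mcm_deg => // j /JA; apply: Ae.
have sub : (fpowerset (below A m) `<=` fpowerset U)%fset.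
  by rewrite fpowersetS; apply/fsubsetP => x; rewrite !inE => /andP[].
have Em J : J \in fpowerset U -> tower_step A J && (below (mcm [set` J]) m != fset0) =
    (J \in fpowerset (below A m)) && (1 < #|` J|)%N.
  move=> JU; apply/andP/andP => [[/asboolP[JA J1 _] /fset0Pn[x]]|[]].
    rewrite in_below // => /asboolP[[cx _] xm]; split=> //.
    rewrite fpowersetE; apply/fsubsetP => j jJ; rewrite in_below //; apply/asboolP.
    by split; [exact: JA | exact: ldiv_trans (cx _ jJ) xm].
  rewrite fpowersetE => /fsubsetP JA J1.
  have Jm j : j \in J -> A j /\ ldiv j m by move=> /JA; rewrite in_below // => /asboolP.
  have [|x mx xm] := @mcm_below [set` J] m; first by move=> j /Jm[].
  split; first by apply/asboolP; split=> //; [move=> j /Jm[] | exists x].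
  by apply/fset0Pn; exists x; rewrite in_below //; apply/asboolP.
rewrite (_ : \sum_(J <- _ | _) _ =
  \sum_(J <- fpowerset (below A m) | (1 < #|` J|)%N) (-1) ^+ #|` J|); last first.
  transitivity (\sum_(J <- (fpowerset U : seq {fset M}) |
      (J \in fpowerset (below A m)) && (1 < #|` J|)%N) ((-1) ^+ #|` J| : int)).
    rewrite [LHS]big_mkcond [RHS]big_mkcond; apply: eq_big_seq => J /Em <-.
    by case: tower_step; case: (_ != _); rewrite ?mulr1 ?mulr0.
  rewrite -[LHS]big_filter -[RHS]big_filter; apply: perm_big; apply: uniq_perm.
  - by rewrite filter_uniq ?fset_uniq.
  - by rewrite filter_uniq ?fset_uniq.
  - move=> J; rewrite !mem_filter [RHS]andbC.
    have [JA|//] := boolP (J \in fpowerset (below A m)).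
    by rewrite (fsubsetP sub _ JA) andbT.
by rewrite sum_fpowerset_sign_gt1 /tower_top /= addKr.
Qed.

(* The coefficient with which [x] enters the skew growth function. *)
Definition tower_weight (A : set M) x : int :=
  (x == 1%g)%:Z + \sum_(T <- towers d A) tower_sign T * `[< tower_top A T x >]%:Z.

Lemma card_below A m : (#|` below A m|)%:Z =
  \sum_(x <- U | `[< ldiv x m >]) `[< A x >]%:Z.
Proof.
rewrite card_fset_sum1 big_fset /= -natz natr_sum big_mkcond [RHS]big_mkcond /=.
by apply: eq_bigr => x _; rewrite asbool_and; case: `[< A x >]; case: `[< _ >].
Qed.

(** The element 1 contributes 1; the towers contribute -1 unless [m] is 1, as every other element
    has a left divisor in [A]. *)
Lemma sum_tower_weight A m : (forall x, A x -> (0 < deg x)%N) ->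
  (forall x, x <> 1%g -> exists2 y, A y & ldiv y x) -> (deg m <= d)%N ->
  \sum_(x <- U | `[< ldiv x m >]) tower_weight A x = (m == 1%g)%:Z.
Proof.
move=> A0 Adiv md; have deg1 : deg 1%g = 0%N by have := degM 1%g 1%g; rewrite mulg1; lia.
rewrite big_split /= exchange_big /= sum_fset_eq ?inU ?deg1 //.
rewrite (eq_bigr (fun T => tower_sign T * (#|` below (tower_top A T) m|)%:Z)); last first.
  by move=> T _; rewrite -big_distrr /= card_below.
rewrite (sum_tower_sign (e := 1%N)) ?leqnSn //.
have -> : `[< ldiv 1%g m >] = true by apply/asboolP; exists m; rewrite mul1g.
have -> : (below A m != fset0) = (m != 1%g).
  apply/fset0Pn/idP => [[x]|/eqP/Adiv[x Ax xm]]; last first.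
    by exists x; rewrite in_below //; apply/asboolP.
  rewrite in_below // => /asboolP[/A0 x0 /deg_ldiv xm].
  by apply: contraTneq x0 => m1; rewrite m1 deg1 leqn0 in xm; rewrite (eqP xm).
by case: (m == _).
Qed.

(** Left divisors of [m] other than [m] have smaller degree, so by induction their terms agree and
    cancel. *)
Lemma sum_ldiv_inj (v w : M -> int) :
  (forall m, (deg m <= d)%N ->
     \sum_(x <- U | `[< ldiv x m >]) v x = \sum_(x <- U | `[< ldiv x m >]) w x) ->
  forall m, (deg m <= d)%N -> v m = w m.
Proof.
move=> vw m; have [k] := ubnP (deg m); elim: k m => // k IH m; rewrite ltnS => mk md.
have := vw m md; rewrite !(big_mkcond (fun x => `[< ldiv x m >])) /=.
rewrite !(bigD1_seq m) ?inU ?fset_uniq //=.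
have -> : `[< ldiv m m >] = true by apply/asboolP; apply: ldiv_refl.
rewrite (eq_bigr (fun x => if `[< ldiv x m >] then w x else 0)); first exact: addIr.
move=> x xm; case: asboolP => // dx.
have lt_xm : (deg x < deg m)%N.
  by rewrite ltnNge; apply: contra xm => /(ldiv_deg_eq dx) ->.
by apply: IH; [exact: leq_trans lt_xm mk | exact: leq_trans (ltnW lt_xm) md].
Qed.

Lemma deg_series_top A T :
  deg_series deg (tower_top A T) d =
  \sum_(x <- U) `[< tower_top A T x >]%:Z * (deg x == d)%:Z.
Proof.
rewrite /deg_series (fsbigE [seq x <- U | x \in tower_top A T]).
- rewrite big_filter_cond [LHS]big_mkcond; apply: eq_bigr => x _.
  have -> : `[< tower_top A T x >] = (x \in tower_top A T).
    by apply/asboolP/idP => [/mem_set|/set_mem].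
  by rewrite andbb; case: (_ \in _); rewrite ?mul1r ?mul0r.
- by rewrite filter_uniq ?fset_uniq.
- by move=> x /=; rewrite mem_filter => /andP[/set_mem].
- move=> x Tx; rewrite mem_filter mem_set //= inU => xd.
  by case: eqP xd => // ->; rewrite leqnn.
Qed.

Lemma skew_growth_weight A : (forall x, A x -> (0 < deg x)%N) ->
  skew_growth A deg d = \sum_(x <- U) tower_weight A x * (deg x == d)%:Z.
Proof.
move=> A0; have deg1 : deg 1%g = 0%N by have := degM 1%g 1%g; rewrite mulg1; lia.
rewrite /skew_growth (fsbigE (towers d A)) ?towers_uniq; first last.
(* A tower missing from the list has no top element of degree [d]. *)
- move=> T tT /negP nT; rewrite deg_series_top [X in _ * X]big1 ?mulr0 // => x _.
  case: asboolP => [Tx|]; rewrite ?mul0r // mul1r; case: eqP => // xd; case: nT.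
  by apply: (mem_towers (e := 1%N) _ _ tT Tx) => //; rewrite ?xd // leqnSn.
- by move=> T /towersP.
- by [].
rewrite big_mkcond (eq_big_seq (fun T => \sum_(x <- U)
    tower_sign T * `[< tower_top A T x >]%:Z * (deg x == d)%:Z)); last first.
  move=> T /towersP tT; rewrite mem_set // deg_series_top (tower_signE tT) big_distrr /=.
  by apply: eq_bigr => x _; rewrite mulrA.
rewrite exchange_big /=.
have -> : (d == 0%N)%:Z = \sum_(x <- U) (x == 1%g)%:Z * (deg x == d)%:Z.
  rewrite (bigD1_seq 1%g) ?inU ?deg1 ?fset_uniq //= eqxx mul1r big1 ?addr0 1?eq_sym //.
  by move=> x /negPf ->; rewrite mul0r.
rewrite -big_split /=; apply: eq_bigr => x _.
by rewrite /tower_weight mulrDl big_distrl.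
Qed.

End BoundedDegree.

(** The list [s] encodes a finitely supported function; having the same sums over left divisors as
    the tower weights, it agrees with them by inversion. *)
Theorem skew_growth_ldiv (A : set M) (s : seq (int * M)) :
  (forall d, exists U : {fset M}, forall x, (x \in U) = (deg x <= d)%N) ->
  (forall x, A x -> (0 < deg x)%N) ->
  (forall x, x <> 1%g -> exists2 y, A y & ldiv y x) ->
  (forall m, \sum_(p <- s) p.1 * `[< ldiv p.2 m >]%:Z = (m == 1%g)%:Z) ->
  forall d, skew_growth A deg d = \sum_(p <- s) p.1 * (deg p.2 == d)%:Z.
Proof.
move=> finU A0 Adiv sP d; have [U inU] := finU d.
rewrite (skew_growth_weight inU A0).
pose w x : int := \sum_(p <- s) p.1 * (x == p.2)%:Z.
have sum_eq (P : pred M) e : (P e -> (deg e <= d)%N) ->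
    \sum_(x <- U | P x) (x == e)%:Z = (P e)%:Z.
  move=> Pe; have [eU|eU] := boolP (e \in U); first exact: sum_fset_eq.
  rewrite big_seq_cond big1 => [|x /andP[xU _]].
    by case: (P e) Pe => // /(_ isT); rewrite -inU (negPf eU).
  by case: eqP xU => // ->; rewrite (negPf eU).
have wE m : (deg m <= d)%N -> tower_weight d U A m = w m.
  apply: (sum_ldiv_inj inU) => {}m md.
  rewrite sum_tower_weight // -sP exchange_big /=; apply: eq_bigr => p _.
  rewrite -big_distrr /= sum_eq // => /asboolP/deg_ldiv pm; exact: leq_trans pm md.
rewrite (eq_big_seq (fun x => \sum_(p <- s) p.1 * (x == p.2)%:Z * (deg x == d)%:Z)).
  rewrite exchange_big /=; apply: eq_bigr => p _.
  under eq_bigr do rewrite -mulrA; rewrite -big_distrr /=; congr (_ * _).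
  rewrite -(sum_eq (fun x => deg x == d)) => [|/eqP -> //].
  by rewrite [RHS]big_mkcond; apply: eq_bigr => x _; case: (deg x == d); rewrite ?mulr1 ?mulr0.
by move=> x; rewrite inU => /wE ->; rewrite big_distrl.
Qed.

End Towers.

(** * Words in H_n^+ *)

Section HnWords.
Local Open Scope group_scope.
Variable n : nat.

Notation M := (Hn n).
Notation cls := (word_class (Hn_rel n)).

Let oa : 'I_3 := @Ordinal 3 0 isT.
Let ob : 'I_3 := @Ordinal 3 1 isT.
Let oc : 'I_3 := @Ordinal 3 2 isT.

(** [locked] keeps simplification from unfolding products in the quotient. *)
Definition la (x : M) : M := locked ((cls [:: oa] : M) * x).
Definition lb (x : M) : M := locked ((cls [:: ob] : M) * x).
Definition lc (x : M) : M := locked ((cls [:: oc] : M) * x).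
Definition lcb (x : M) : M := lc (lb x).

Lemma I3_case (P : 'I_3 -> Prop) : P oa -> P ob -> P oc -> forall x, P x.
Proof.
move=> Pa Pb Pc [[|[|[|//]]] lt_i].
- by rewrite (_ : Ordinal _ = oa) //; apply: val_inj.
- by rewrite (_ : Ordinal _ = ob) //; apply: val_inj.
- by rewrite (_ : Ordinal _ = oc) //; apply: val_inj.
Qed.

Lemma cls_cat u v : cls (u ++ v) = (cls u : M) * (cls v : M).
Proof. exact: word_class_cat. Qed.

Lemma cls_nil : cls [::] = (1 : M). Proof. by []. Qed.

Lemma cls_a w : cls (oa :: w) = la (cls w).
Proof. by rewrite /la -lock -cls_cat. Qed.
Lemma cls_b w : cls (ob :: w) = lb (cls w).
Proof. by rewrite /lb -lock -cls_cat. Qed.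
Lemma cls_c w : cls (oc :: w) = lc (cls w).
Proof. by rewrite /lc -lock -cls_cat. Qed.

Lemma laM x y : la (x * y) = la x * y.
Proof. by rewrite /la -!lock mulgA. Qed.
Lemma lbM x y : lb (x * y) = lb x * y.
Proof. by rewrite /lb -!lock mulgA. Qed.
Lemma lcM x y : lc (x * y) = lc x * y.
Proof. by rewrite /lc -!lock mulgA. Qed.
Notation dg := (deg (Hn_rel n)).

Lemma dg_la x : dg (la x) = (dg x).+1.
Proof. by rewrite /la -lock degM ?deg_word_class //; apply: Hn_rel_homogeneous. Qed.
Lemma dg_lb x : dg (lb x) = (dg x).+1.
Proof. by rewrite /lb -lock degM ?deg_word_class //; apply: Hn_rel_homogeneous. Qed.
Lemma dg_lc x : dg (lc x) = (dg x).+1.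
Proof. by rewrite /lc -lock degM ?deg_word_class //; apply: Hn_rel_homogeneous. Qed.
Lemma lcbM x y : lcb (x * y) = lcb x * y. Proof. by rewrite /lcb lbM lcM. Qed.
Lemma iter_lcbM p x y : iter p lcb (x * y) = iter p lcb x * y.
Proof. by elim: p => //= p ->; rewrite lcbM. Qed.
Lemma iter_lcM p x y : iter p lc (x * y) = iter p lc x * y.
Proof. by elim: p => //= p ->; rewrite lcM. Qed.

Lemma cls_rel u v : (u, v) \in Hn_rel n -> cls u = cls v.
Proof. by move=> uv; apply/word_classP/cong_rel. Qed.

Lemma lab x : la (lb x) = lb (lc x).
Proof.
rewrite -[x]mul1g !(lbM, lcM, laM) -cls_nil -!(cls_a, cls_b, cls_c).
by congr (_ * _); apply: cls_rel; rewrite !inE eqxx !orbT.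
Qed.

Lemma lac x : la (lc x) = lc (la x).
Proof.
rewrite -[x]mul1g !(lbM, lcM, laM) -cls_nil -!(cls_a, cls_b, cls_c).
by congr (_ * _); apply: cls_rel; rewrite !inE eqxx !orbT.
Qed.

Lemma lac_iter k x : la (iter k lc x) = iter k lc (la x).
Proof. by elim: k => //= k IH; rewrite lac IH. Qed.

Lemma lb_iter_lc k x : lb (iter k lc x) = iter k la (lb x).
Proof. by elim: k x => //= k IH x; rewrite -lab IH. Qed.

Lemma cls_abn p w :
  cls (flatten (nseq p [:: oa; ob]) ++ w) = iter p (fun x => la (lb x)) (cls w).
Proof. by elim: p => //= p IH; rewrite !(cls_a, cls_b) IH. Qed.

Lemma iter_lab p x : iter p (fun x => la (lb x)) (lb x) = lb (iter p lcb x).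
Proof. by elim: p => //= p ->; rewrite lab. Qed.

(** The first relation as cbbB = bbBa with B = (cb)^n, since (ab)^n b = b(cb)^n. *)
Lemma lcbb_rel x : lc (lb (lb (iter n lcb x))) = lb (lb (iter n lcb (la x))).
Proof.
rewrite -[x]mul1g !(laM, iter_lcbM, lbM, lcM); apply: (congr1 (fun y => y * x)).
rewrite -!iter_lab -cls_nil -!(cls_a, cls_b) -!cls_abn -!(cls_b, cls_c).
by apply/esym/cls_rel; rewrite inE eqxx.
Qed.

Lemma dg_lcb x : dg (lcb x) = (dg x).+2.
Proof. by rewrite dg_lc dg_lb. Qed.
Lemma dg_iter_lc k x : dg (iter k lc x) = (k + dg x)%N.
Proof. by elim: k => //= k IH; rewrite dg_lc IH. Qed.
Lemma dg_iter_lcb k x : dg (iter k lcb x) = (k.*2 + dg x)%N.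
Proof. by elim: k => //= k IH; rewrite dg_lcb IH doubleS. Qed.
Lemma dg_one : dg (1 : M) = 0%N.
Proof. exact: (deg_word_class [::] (@Hn_rel_homogeneous n)). Qed.

(* Since b c^s = a^s b, the first relation reads b h = c b h' when [tau h h'].
   These are the only coincidences between the forms c^k b g: see
   [eval_shape_inj]. *)
Definition tau (h h' : M) : Prop := exists s u,
  h = iter s lc (lb (iter n lcb (la u))) /\ h' = iter s lc (lb (iter n lcb u)).

Lemma tauM h h' x : tau h h' -> tau (h * x) (h' * x).
Proof.
move=> [s [u [-> ->]]]; exists s, (u * x).
by rewrite laM !iter_lcbM !lbM !iter_lcM.
Qed.

Lemma tau_lc h h' : tau h h' -> tau (lc h) (lc h').
Proof. by move=> [s [u [-> ->]]]; exists s.+1, u. Qed.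

Lemma tau_iter_lc k h h' : tau h h' -> tau (iter k lc h) (iter k lc h').
Proof. by elim: k => //= k IH /IH/tau_lc. Qed.

(** Moved across b, c^s becomes a^s, which commutes with the c produced by the first relation. *)
Lemma tau_lb h h' : tau h h' -> lb h = lc (lb h').
Proof.
move=> [s [u [-> ->]]].
rewrite !lb_iter_lc -lcbb_rel; elim: s => //= s ->; exact: lac.
Qed.

Lemma dg_tau h h' : tau h h' -> dg h = (dg h').+1.
Proof.
by move=> [s [u [-> ->]]]; rewrite !(dg_iter_lc, dg_iter_lcb, dg_lb, dg_la); lia.
Qed.

(** A pair (k, g) stands for c^k b g; the equivalence is generated by c^k b h = c^(k+1) b h' for
    [tau h h']. *)
Inductive zig : nat * M -> nat * M -> Prop :=
| zig_tau k h h' : tau h h' -> zig (k, h) (k.+1, h')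
| zig_refl p : zig p p
| zig_sym p q : zig p q -> zig q p
| zig_trans p q r : zig p q -> zig q r -> zig p r.

Lemma zigM p q x : zig p q -> zig (p.1, p.2 * x) (q.1, q.2 * x).
Proof.
elim=> {p q} [k h h' hh'|p|p q _|p q r _ + _]; first exact/zig_tau/tauM.
- exact: zig_refl.
- exact: zig_sym.
- exact: zig_trans.
Qed.

(** Left multiplication by c^i a^j sends c^k b g to c^(i+k) b c^j g. *)
Lemma zig_shift i j p q : zig p q ->
  zig (i + p.1, iter j lc p.2)%N (i + q.1, iter j lc q.2)%N.
Proof.
elim=> {p q} [k h h' hh'|p|p q _|p q r _ + _].
- by rewrite addnS; apply/zig_tau/tau_iter_lc.
- exact: zig_refl.
- exact: zig_sym.
- exact: zig_trans.
Qed.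

(* [inl (i, j)] stands for c^i a^j and [inr (k, g)] for c^k b g, which cover M. *)
Definition shape : Type := ((nat * nat) + (nat * M))%type.

Definition eval_shape (d : shape) : M :=
  match d with
  | inl (i, j) => iter i lc (iter j la 1)
  | inr (k, g) => iter k lc (lb g)
  end.

(** [w] is the class of the word after [x]; it is stored whole when [x] is b, so only the part
    before the first b is normalised. *)
Definition shape_cons (x : 'I_3) (w : M) (d : shape) : shape :=
  match val x, d with
  | 0%N, inl (i, j) => inl (i, j.+1)
  | 0%N, inr (k, g) => inr (k, lc g)
  | 1%N, _ => inr (0%N, w)
  | _, inl (i, j) => inl (i.+1, j)
  | _, inr (k, g) => inr (k.+1, g)
  end.

Fixpoint word_shape (w : seq 'I_3) : shape :=
  if w is x :: w' then shape_cons x (cls w') (word_shape w') else inl (0%N, 0%N).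

Definition shape_mul (d1 : shape) (w2 : M) (d2 : shape) : shape :=
  match d1, d2 with
  | inl (i, j), inl (i', j') => inl (i + i', j + j')%N
  | inl (i, j), inr (k, g) => inr (i + k, iter j lc g)%N
  | inr (k, g), _ => inr (k, g * w2)
  end.

Definition shape_sim (d1 d2 : shape) : Prop :=
  match d1, d2 with
  | inl p, inl q => p = q
  | inr p, inr q => zig p q
  | _, _ => False
  end.

Lemma eval_word_shape w : eval_shape (word_shape w) = cls w.
Proof.
elim: w => [|x w IH] //=; elim/I3_case: x; rewrite ?(cls_a, cls_b, cls_c) -?IH.
- case: (word_shape w) => [[i j]|[k g]] /=; first by rewrite lac_iter.
  by rewrite lac_iter lab.
- by rewrite /= IH.
- by case: (word_shape w) => [[i j]|[k g]].
Qed.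

Lemma word_shape_cat u v :
  word_shape (u ++ v) = shape_mul (word_shape u) (cls v) (word_shape v).
Proof.
elim: u => [|x u IH] /=; first by case: (word_shape v) => [[]|[]].
rewrite IH; elim/I3_case: x.
- case: (word_shape u) (word_shape v) => [[i j]|[k g]] [[i1 j1]|[k1 g1]]; by rewrite /shape_cons /= ?lcM.
- by rewrite /= cls_cat.
- by case: (word_shape u) (word_shape v) => [[i j]|[k g]] [[i' j']|[k' g']].
Qed.

Lemma shape_sim_refl d : shape_sim d d.
Proof. by case: d => //= p; apply: zig_refl. Qed.

(** The relations ab = bc and ac = ca leave the shape unchanged, the first relation is one [tau]
    step, and [zig] is compatible with products. *)
Lemma cong_shape u v : cong (Hn_rel n) u v ->
  shape_sim (word_shape u) (word_shape v).
Proof.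
elim=> {u v} [u v|u|u v _|u v w _ IH1 _ IH2|u u' v v' _ IHu cv IHv].
- rewrite !inE => /or3P[] /eqP[-> ->] /=; last by [].
  + apply: zig_tau; exists 0%N, 1; rewrite /=.
    have E w : cls (flatten (nseq n [:: oa; ob]) ++ ob :: w) = lb (iter n lcb (cls w)).
      by rewrite cls_abn cls_b iter_lab.
    by rewrite !E cls_a.
  + rewrite cls_c; exact: zig_refl.
- exact: shape_sim_refl.
- case: (word_shape u) (word_shape v) => [p|p] [q|q] //=; exact: zig_sym.
- move: IH1 IH2; case: (word_shape u) (word_shape v) (word_shape w) =>
    [p|p] [q|q] [r|r] //=; first by move=> ->.
  exact: zig_trans.
- rewrite !word_shape_cat; have -> : cls v = cls v' by apply/word_classP.
  move: IHu IHv; case: (word_shape u) (word_shape u') => [[i j]|p] [[i' j']|q] //=.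
    move=> [<- <-]; case: (word_shape v) (word_shape v') => [[k l]|[k g]] [[k' l']|[k' g']] //=.
      by move=> [<- <-].
    exact: (@zig_shift i j (k, g) (k', g')).
  move=> pq _; move: (zigM (cls v') pq); by case: p q {pq} => [k g] [k' g'].
Qed.

Lemma shape_of d : exists w, cls w = eval_shape d /\ word_shape w = d.
Proof.
case: d => [[i j]|[k g]].
  exists (nseq i oc ++ nseq j oa); split.
    elim: i => /= [|i IH]; last by rewrite cls_c IH.
    by elim: j => //= j IH; rewrite cls_a IH.
  elim: i => /= [|i ->] //.
  by elim: j => //= j ->.
exists (nseq k oc ++ ob :: repr g); have Eg : cls (repr g) = g by apply: word_class_repr.
split.
  elim: k => /= [|k IH]; last by rewrite cls_c IH.
  by rewrite cls_b Eg.
by elim: k => /= [|k ->] //; rewrite Eg.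
Qed.

Lemma eval_shape_inj d1 d2 : eval_shape d1 = eval_shape d2 -> shape_sim d1 d2.
Proof.
have [w1 [<- <-]] := shape_of d1; have [w2 [<- <-]] := shape_of d2.
by move=> /word_classP/cong_shape.
Qed.

Lemma shapeP x : exists d, x = eval_shape d.
Proof.
exists (word_shape (repr x)); rewrite eval_word_shape; exact/esym/word_class_repr.
Qed.

End HnWords.

(** * Left cancellation and common multiples *)

Section HnCancel.
Local Open Scope group_scope.
Variable n : nat.
Hypothesis n_gt0 : (0 < n)%N.

Notation M := (Hn n).
Notation dg := (deg (Hn_rel n)).
Notation "''E_' p x" := (iter p (@lcb n) x) (at level 10, p at level 8, x at level 9).

Definition dom (m : M) := exists h, tau m h.
Definition ran (m : M) := exists h, tau h m.

Fixpoint taus k (g g' : M) : Prop :=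
  if k is k'.+1 then exists h, tau g h /\ taus k' h g' else g = g'.

Lemma taus_cat i j g h t : taus i g h -> taus j h t -> taus (i + j) g t.
Proof.
elim: i g => [|i IH] g /= => [-> //|[k [gk kh]] ht].
by exists k; split=> //; apply: IH.
Qed.

Lemma taus_split i j g t : taus (i + j) g t -> exists2 h, taus i g h & taus j h t.
Proof.
elim: i g => [|i IH] g /= => [gt|[k [gk /IH [h kh ht]]]]; first by exists g.
by exists h => //; exists k.
Qed.

Lemma dg_taus i g t : taus i g t -> dg g = (i + dg t)%N.
Proof. by elim: i g => [|i IH] g /= => [-> //|[k [/dg_tau -> /IH ->]]]. Qed.

Lemma lb_taus i g t : taus i g t -> lb g = iter i (@lc n) (lb t).
Proof.
elim: i g => [|i IH] g => [-> //|[k [/tau_lb -> /IH ->]]] //.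
Qed.

Lemma tau_base s u : tau (iter s (@lc n) (lb ('E_n (la u)))) (iter s (@lc n) (lb ('E_n u))).
Proof. by exists s, u. Qed.

Lemma E_S p (x : M) : 'E_(p.+1) x = 'E_p (lcb x). Proof. exact: iterSr. Qed.

Lemma E_split p q (x : M) : (q <= p)%N -> 'E_p x = 'E_q ('E_(p - q) x).
Proof. by move=> qp; rewrite -iterD subnKC. Qed.

Lemma tau_E u : tau ('E_(n.+1) (la u)) ('E_(n.+1) u).
Proof. exact: (@tau_base 1 u). Qed.

Lemma lcb_c (v : M) : lcb (lc v) = la (lcb v).
Proof. by rewrite /lcb -lab lac. Qed.

Lemma lcb_ac (v : M) : lcb (la (lc v)) = la (lcb (la v)).
Proof. by rewrite lac lcb_c. Qed.

(* The clauses are proved by one simultaneous induction on the degree: each of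
   them, once a letter b is stripped, needs several others in smaller degree.
   [good_dom] and [good_ran] compensate for the absence of least common
   multiples: (cb)^p w may be a multiple of b in unexpected ways, but it meets
   the domain of [tau] only in the evident way. *)
Record good (m : M) : Prop := Good {
  good_c : forall x y, m = lc x -> m = lc y -> x = y;
  good_b : forall x y, m = lb x -> m = lb y -> x = y;
  good_a : forall x y, m = la x -> m = la y -> x = y;
  good_ac : forall x y, m = la x -> m = lc y -> exists2 v, x = lc v & y = la v;
  good_ab : forall x y, m = la x -> m = lb y -> exists2 v, x = lb v & y = lc v;
  good_dom : forall p w, (0 < p <= n.+1)%N -> m = 'E_p w -> dom m ->
    exists u, w = 'E_(n.+1 - p) (la u);
  good_ran : forall p w, (0 < p <= n.+1)%N -> m = 'E_p w -> ran m ->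
    exists u, w = 'E_(n.+1 - p) u;
  good_tau : forall h h', tau m h -> tau m h' -> h = h';
  good_tauV : forall h h', tau m h -> tau h' h -> h' = m;
  good_domc : forall g, m = lc g -> dom m -> dom g;
  good_ranc : forall g, m = lc g -> ran m -> ran g }.

(** * Inductive step: from degrees below [D] to degree [D] *)

Section Step.
Variable D : nat.
Hypothesis IH : forall m, (dg m < D)%N -> good m.

Lemma taus_fun i g t t' : (dg g < D)%N -> taus i g t -> taus i g t' -> t = t'.
Proof.
elim: i g => [|i IHi] g /= gD; first by move=> <-.
move=> [h [gh ht]] [h' [gh' ht']].
have eqh := good_tau (IH gD) gh gh'; rewrite -eqh in ht'.
by apply: IHi ht ht'; rewrite -ltnS -(dg_tau gh) ltnW.
Qed.

Lemma taus_inj i g g' t : (dg g < D)%N -> taus i g t -> taus i g' t -> g = g'.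
Proof.
elim: i g g' => [|i IHi] g g' /= gD; first by move=> -> ->.
move=> [h [gh ht]] [h' [gh' ht']].
have eqh : h = h'.
  by apply: IHi ht ht'; rewrite -ltnS -(dg_tau gh) ltnW.
by rewrite -eqh in gh'; apply/esym/(good_tauV (IH gD) gh).
Qed.

Definition joins (p q : nat * M) := exists i j t,
  [/\ taus i p.2 t, taus j q.2 t & (p.1 + i = q.1 + j)%N].

Lemma zig_dg p q : zig p q -> (p.1 + dg p.2 = q.1 + dg q.2)%N.
Proof. by elim=> {p q} [k h h' /dg_tau ->|//|//|p q r _ -> _ ->] //=; lia. Qed.

(** Of two [tau] chains leaving the same element one extends the other, as [tau] is functional in
    small degree; so a zigzag reduces to two forward chains with a common end. *)
Lemma zig_joins p q : zig p q -> (p.1 + dg p.2 < D)%N -> joins p q.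
Proof.
elim=> {p q} [k h h' hh' _|p _|p q pq IHpq|p q r pq IHpq qr IHqr].
- by exists 1%N, 0%N, h'; split=> //=; [exists h' | lia].
- by exists 0%N, 0%N, p.2; split.
- by rewrite -(zig_dg pq) => /IHpq[i [j [t [it jt e]]]]; exists j, i, t; split.
move=> pD; have qD : (q.1 + dg q.2 < D)%N by rewrite -(zig_dg pq).
have [i [j [t [it jt e]]]] := IHpq pD.
have [i' [j' [t' [it' jt' e']]]] := IHqr qD.
have q2D : (dg q.2 < D)%N by apply: leq_ltn_trans qD; rewrite leq_addl.
have [ji'|i'j] := leqP j i'.
  move: (it'); rewrite -(subnKC ji') => /taus_split[h jh ht'].
  rewrite -(taus_fun q2D jt jh) in ht'.
  exists (i + (i' - j))%N, j', t'; split=> //; [exact: taus_cat ht'|lia].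
move: (jt); rewrite -(subnKC (ltnW i'j)) => /taus_split[h jh ht'].
rewrite -(taus_fun q2D it' jh) in ht'.
exists i, (j' + (j - i'))%N, t; split=> //; [exact: taus_cat ht'|lia].
Qed.

(** The chains from [g] and [g'] meet, the first being [k] steps longer; injectivity of [tau] undoes
    the remaining steps. *)
Lemma lb_inv k g g' : (dg g < D)%N -> lb g = iter k (@lc n) (lb g') -> taus k g g'.
Proof.
move=> gD e; have /= := @eval_shape_inj n (inr (0%N, g)) (inr (k, g')) e.
move=> /zig_joins /(_ gD) [i [j [t [/= it jt]]]]; rewrite add0n => ei.
move: it; rewrite ei => /taus_split[h kh ht].
suff <- : h = g' by [].
by apply: taus_inj ht jt; apply: leq_ltn_trans gD; rewrite (dg_taus kh) leq_addl.
Qed.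

(** For forms containing b, equality means that the chains meet, and the common end also identifies
    the forms with one c less. *)
Lemma cancel_c x y : (dg (lc x) <= D)%N -> lc x = lc y -> x = y.
Proof.
have [[[i j]|[k g]] ->] := shapeP x; have [[[i' j']|[k' g']] ->] := shapeP y => /= xD e.
- by have /= [-> ->] := @eval_shape_inj n (inl (i.+1, j)) (inl (i'.+1, j')) e.
- by have /= := @eval_shape_inj n (inl (i.+1, j)) (inr (k'.+1, g')) e.
- by have /= := @eval_shape_inj n (inr (k.+1, g)) (inl (i'.+1, j')) e.
have /= := @eval_shape_inj n (inr (k.+1, g)) (inr (k'.+1, g')) e.
move=> /zig_joins /=; case.
  by move: xD; rewrite dg_lc dg_iter_lc dg_lb; lia.
move=> i1 [j1 [t [/= it jt eij]]].
rewrite (lb_taus it) (lb_taus jt) -!iterD; congr iter; lia.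
Qed.

Lemma cancel_iter_c k x y :
  (dg (iter k (@lc n) x) <= D)%N -> iter k (@lc n) x = iter k (@lc n) y -> x = y.
Proof.
elim: k => //= k IHk kD /(cancel_c kD); apply: IHk.
by apply: leq_trans kD; rewrite dg_lc.
Qed.

Lemma cancel_b x y : (dg (lb x) <= D)%N -> lb x = lb y -> x = y.
Proof. by rewrite dg_lb => xD e; apply: (@lb_inv 0). Qed.

Lemma cancel_E p x y : (dg ('E_p x) <= D)%N -> 'E_p x = 'E_p y -> x = y.
Proof.
elim: p => //= p IHp; rewrite dg_lcb => pD e; apply: IHp; first by lia.
apply: cancel_b; first by rewrite dg_lb; lia.
by apply: cancel_c => //; rewrite dg_lc dg_lb.
Qed.

(** [good_domc] gives a step from the element behind the c, and functionality of [tau] identifies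
    the results. *)
Lemma taus_lc i g h : (dg (lc g) < D)%N -> taus i (lc g) h ->
  exists2 h', h = lc h' & taus i g h'.
Proof.
elim: i g => [|i IHi] g gD /= => [<-|[k [gk kh]]]; first by exists g.
have [k' gk'] : dom g by apply: (good_domc (IH gD) erefl); exists k.
have ek := good_tau (IH gD) gk (tau_lc gk'); rewrite ek in kh.
have [|h' -> k'h'] := IHi _ _ kh; first by move: gD (dg_tau gk'); rewrite !dg_lc; lia.
by exists h' => //; exists k'.
Qed.

Lemma taus_lcV i g h : (dg g < D)%N -> taus i g (lc h) ->
  exists2 g', g = lc g' & taus i g' h.
Proof.
elim: i g => [|i IHi] g gD /= => [->|[k [gk kh]]]; first by exists h.
have kD : (dg k < D)%N by move: gD (dg_tau gk); lia.
have [k' ek k'h] := IHi _ kD kh; rewrite ek in gk kD.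
have [g' gk'] : ran k' by apply: (good_ranc (IH kD) erefl); exists g.
exists g'; last by exists k'.
by apply/esym/(good_tauV (IH gD) gk)/tau_lc.
Qed.

(** As a c^k b g = c^k b c g, the equality yields a chain between the elements behind b, from which
    [taus_lc] strips the c. *)
Lemma cancel_a x y : (dg (la x) <= D)%N -> la x = la y -> x = y.
Proof.
have [[[i j]|[k g]] ->] := shapeP x; have [[[i' j']|[k' g']] ->] := shapeP y => /=.
- rewrite !lac_iter => xD e.
  by have /= [-> ->] := @eval_shape_inj n (inl (i, j.+1)) (inl (i', j'.+1)) e.
- rewrite !lac_iter lab => xD e.
  by have /= := @eval_shape_inj n (inl (i, j.+1)) (inr (k', lc g')) e.
- rewrite !lac_iter lab => xD e.
  by have /= := @eval_shape_inj n (inr (k, lc g)) (inl (i', j'.+1)) e.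
rewrite !lac_iter !lab => xD e.
wlog kk' : k k' g g' xD e / (k <= k')%N.
  move=> W; have [kk'|kk'] := leqP k k'; first exact: W.
  by apply/esym/W => //; [rewrite -e | exact: ltnW].
move: e; rewrite -(subnKC kk') iterD => /(cancel_iter_c xD) e.
have gD : (dg (lc g) < D)%N by move: xD; rewrite dg_iter_lc dg_lb; lia.
have gg' := lb_inv gD e; have [h' eh gh'] := taus_lc gD gg'.
rewrite (lb_taus gh') iterD (cancel_c _ eh) //.
by move: gD; rewrite (dg_taus gg'); lia.
Qed.

Lemma split_ac x y : (dg (la x) <= D)%N -> la x = lc y ->
  exists2 v, x = lc v & y = la v.
Proof.
move=> xD e; suff [v ev] : exists v, x = lc v.
  exists v => //; apply/esym/cancel_c; last by rewrite -e ev lac.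
  by rewrite -lac -ev.
move: xD e; have [[[[|i] j]|[[|k] g]] ->] := shapeP x; rewrite /= => xD e.
- have [[[i' j']|[k' g']] ey] := shapeP y; rewrite ey in e.
    by have /= := @eval_shape_inj n (inl (0%N, j.+1)) (inl (i'.+1, j')) e.
  by have /= := @eval_shape_inj n (inl (0%N, j.+1)) (inr (k'.+1, g')) e.
- by eexists.
(* Here x = bg and ax = bcg is a multiple of c, so a chain of positive length leaves cg. Its first
   step descends to g, making bg a multiple of c. *)
- have [[[i' j']|[k' g']] ey] := shapeP y; rewrite ey lab in e.
    by have /= := @eval_shape_inj n (inr (0%N, lc g)) (inl (i'.+1, j')) e.
  have gD : (dg (lc g) < D)%N by move: xD; rewrite lab dg_lb.
  have [h' _ [k [/tau_lb -> _]]] := taus_lc gD (@lb_inv k'.+1 _ _ gD e).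
  by eexists.
- by eexists.
Qed.

(** A chain leads from [y] to a multiple of c, and [taus_lcV] carries the factor c back to [y]. *)
Lemma split_ab x y : (dg (la x) <= D)%N -> la x = lb y ->
  exists2 v, x = lb v & y = lc v.
Proof.
move=> xD e; suff [v ev] : exists v, y = lc v.
  by exists v => //; apply: cancel_a => //; rewrite e ev lab.
move: xD e; have [[[i j]|[k g]] ->] := shapeP x; rewrite /= lac_iter => xD e.
  by have /= := @eval_shape_inj n (inl (i, j.+1)) (inr (0%N, y)) e.
rewrite lab in xD e.
have yD : (dg y < D)%N by move: xD; rewrite e dg_lb.
by have [v ev _] := taus_lcV yD (lb_inv yD (esym e)); exists v.
Qed.

Lemma split_a_cb x z : (dg (la x) <= D)%N -> la x = lcb z ->
  exists2 v, x = lcb v & z = lc v.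
Proof.
move=> xD /(split_ac xD)[v ex /esym ev].
have [|w evw ez] := split_ab _ ev; last by exists w => //; rewrite ex evw.
by move: xD; rewrite ex !dg_la dg_lc; lia.
Qed.

Lemma split_a_cba x z : (dg (la x) <= D)%N -> la x = lcb (la z) ->
  exists2 v, x = lcb (la v) & z = lc v.
Proof.
move=> xD e; have [w ex /split_ac[|v ez ew]] := split_a_cb xD e.
  by move: xD; rewrite ex !dg_la dg_lcb; move: (congr1 dg e); rewrite ex !(dg_la, dg_lcb); lia.
by exists v => //; rewrite ex ew.
Qed.

Lemma dom_E p w : (dg ('E_p w) < D)%N -> (0 < p <= n.+1)%N -> dom ('E_p w) ->
  exists u, w = 'E_(n.+1 - p) (la u).
Proof. by move=> wD pn; apply: good_dom (IH wD) _ _ pn erefl. Qed.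

Lemma ran_E p w : (dg ('E_p w) < D)%N -> (0 < p <= n.+1)%N -> ran ('E_p w) ->
  exists u, w = 'E_(n.+1 - p) u.
Proof. by move=> wD pn; apply: good_ran (IH wD) _ _ pn erefl. Qed.

Lemma dom_En w : (dg ('E_n w) < D)%N -> dom ('E_n w) -> exists u, w = lcb (la u).
Proof. by move=> wD /(dom_E wD); rewrite subSnn /= leqnSn n_gt0; apply. Qed.

Lemma ran_En w : (dg ('E_n w) < D)%N -> ran ('E_n w) -> exists u, w = lcb u.
Proof. by move=> wD /(ran_E wD); rewrite subSnn /= leqnSn n_gt0; apply. Qed.

(** The domain condition gives au = cbaz, whence u = cbav and z = cv; the image is (cb)^(n+1) cv =
    (cb)^n acbv. *)
Lemma tau_Ea u h : (dg ('E_n (la u)) < D)%N -> tau ('E_n (la u)) h ->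
  exists v, u = lcb (la v) /\ h = 'E_n (la (lcb v)).
Proof.
move=> uD uh; have [|z ez] := dom_En uD; first by exists h.
have [|v eu ezv] := split_a_cba _ ez.
  by move: uD; rewrite dg_iter_lcb; lia.
exists v; split=> //; move: (uh); rewrite ez -E_S => uh'.
rewrite ez in uD; rewrite -E_S in uD.
by rewrite (good_tau (IH uD) uh' (tau_E z)) E_S ezv lcb_c.
Qed.

Lemma tau_En u h : (dg ('E_n u) < D)%N -> tau ('E_n u) h ->
  exists v, u = lcb (la v) /\ h = 'E_n (lcb v).
Proof.
move=> uD uh; have [|v eu] := dom_En uD; first by exists h.
exists v; split=> //; rewrite eu -E_S in uD uh.
by rewrite (good_tau (IH uD) uh (tau_E v)) E_S.
Qed.

Lemma tau_to_En y z : (dg y < D)%N -> tau y ('E_n z) ->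
  exists v, z = lcb v /\ y = 'E_n (lcb (la v)).
Proof.
move=> yD yz; have zD : (dg ('E_n z) < D)%N by move: yD (dg_tau yz); lia.
have [|v ez] := ran_En zD; first by exists y.
exists v; split=> //; rewrite ez -E_S in yz zD; rewrite -E_S.
exact/esym/(good_tauV (IH yD) yz)/tau_E.
Qed.

Lemma taus_to_En k y z : (dg y < D)%N -> taus k y ('E_n z) -> exists u, y = 'E_n u.
Proof.
elim: k y => [|k IHk] y yD /= => [->|[h [yh hz]]]; first by exists z.
have [|u eh] := IHk h _ hz; first by move: yD (dg_tau yh); lia.
by rewrite eh in yh; have [v [_ ->]] := tau_to_En yD yh; exists (lcb (la v)).
Qed.

Lemma taus_to_Ea k y z : (dg y < D)%N -> taus k y ('E_n (la z)) ->
  exists u, y = 'E_n (la u).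
Proof.
elim: k y => [|k IHk] y yD /= => [->|[h [yh hz]]]; first by exists z.
have hD : (dg h < D)%N by move: yD (dg_tau yh); lia.
have [u eh] := IHk h hD hz; rewrite eh in yh hD.
have [v [ev ->]] := tau_to_En yD yh.
have [|w _ ->] := split_a_cb _ ev; first by move: hD; rewrite dg_iter_lcb; lia.
by rewrite lcb_ac; eexists.
Qed.

(** A step forces [z] to be a times some [z1] and continues from (cb)^(n+1) [z1]; at the end of the
    chain cbz = au, which makes z a multiple of c. *)
Lemma taus_Ea k z u : (dg ('E_n.+1 z) < D)%N -> taus k ('E_n.+1 z) ('E_n (la u)) ->
  exists v, z = lc v.
Proof.
elim: k z => [|k IHk] z zD /= => [|[h [zh hu]]].
  move=> e; have e' : la u = lcb z.
    apply/esym; apply: (@cancel_E n); first by rewrite -E_S ltnW.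
    by rewrite -E_S.
  have [|v _ ->] := split_a_cb _ e'; last by exists v.
  by rewrite e'; move: zD; rewrite E_S dg_iter_lcb; lia.
have [||z1 ez] := @dom_E n.+1 z zD; [by rewrite leqnn | by exists h |].
rewrite subnn /= in ez; rewrite ez in zh zD *.
have eh := good_tau (IH zD) zh (tau_E z1).
have [||v ->] := IHk z1; last by exists (la v); rewrite lac.
  by move: zD; rewrite !dg_iter_lcb dg_la; lia.
by rewrite -eh.
Qed.

(** A step from (cb)^n au has u = cbav; erasing the a behind (cb)^n at both ends leaves the step
    from (cb)^(n+1) av to (cb)^(n+1) v. *)
Lemma taus_la k u u' : (dg ('E_n (la u)) < D)%N ->
  taus k ('E_n (la u)) ('E_n (la u')) -> taus k ('E_n u) ('E_n u').
Proof.
elim: k u => [|k IHk] u uD /= => [e|[h [uh hu]]].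
  suff -> : u = u' by [].
  apply: cancel_a; first by move: uD; rewrite dg_iter_lcb; lia.
  by apply: cancel_E e; apply: ltnW.
have [v [eu eh]] := tau_Ea uD uh; rewrite eh in hu.
exists ('E_n (lcb v)); split; first by rewrite eu -!E_S; apply: tau_E.
apply: IHk => //; rewrite -eh; apply: leq_ltn_trans uD; by rewrite (dg_tau uh).
Qed.

Lemma taus_laV k u u' : (dg ('E_n (la u)) < D)%N ->
  taus k ('E_n u) ('E_n u') -> taus k ('E_n (la u)) ('E_n (la u')).
Proof.
have dgE w : dg ('E_n (la w)) = (dg ('E_n w)).+1.
  by rewrite !dg_iter_lcb dg_la addnS.
elim: k u => [|k IHk] u uD /= => [e|[h [uh hu]]].
  suff -> : u = u' by [].
  by apply: cancel_E e; move: uD; rewrite dgE; lia.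
have [|v [eu eh]] := tau_En _ uh; first by move: uD; rewrite dgE; lia.
rewrite eh in hu; exists ('E_n (la (lcb v))); split.
  by rewrite eu -lcb_ac -lcb_c -!E_S; apply: tau_E.
apply: IHk => //; rewrite dgE -eh -(dg_tau uh); by move: uD; rewrite dgE => /ltnW.
Qed.

Lemma step_dom m p w : (dg m <= D)%N -> (0 < p <= n.+1)%N -> m = 'E_p w -> dom m ->
  exists u, w = 'E_(n.+1 - p) (la u).
Proof.
case: p => // p mD /andP[_]; rewrite ltnS subSS => pn em [_ [s [u [em' _]]]].
have e : lc (lb ('E_p w)) = iter s (@lc n) (lb ('E_n (la u))) by rewrite -em' em.
have wD : (dg (lc (lb ('E_p w))) <= D)%N by rewrite em in mD.
have pD : (dg ('E_p w) < D)%N by move: wD; rewrite dg_lc dg_lb; apply: ltn_trans.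
have final z : 'E_p w = 'E_n z -> w = 'E_(n - p) z.
  by rewrite (E_split _ pn); apply: cancel_E; apply: ltnW.
(* For s = 0 one [tau] step leads from (cb)^n au to (cb)^p w; for s = 1 the prefix cb cancels; for
   larger s a chain of positive length leads from (cb)^p w to (cb)^n au. *)
case: s e {em'} => [|[|s]] e.
- have uD : (dg ('E_n (la u)) < D)%N.
    by move: wD; rewrite e /= dg_lb.
  have [h [uh eh]] := @lb_inv 1 _ _ uD (esym e); rewrite /= in eh.
  have [v [_ eh']] := tau_Ea uD uh.
  by exists (lcb v); apply: final; rewrite -eh' eh.
- exists u; apply: final; apply: cancel_b; last exact: cancel_c e.
  by move: wD; rewrite dg_lc; apply: ltnW.
have wu : taus s.+1 ('E_p w) ('E_n (la u)).
  by move: e; rewrite iterS => /(cancel_c wD)/(lb_inv pD).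
(* [good_dom] excludes exponent 0, so for p = 0 the chain is followed back from its end. *)
case: p pn em e wD pD final wu => [|p] pn em e wD pD final wu.
  by rewrite subn0; apply: taus_to_Ea pD wu.
case: wu => h [wh hu].
have [||z ez] := dom_E pD; [by lia | by exists h |].
have ew : 'E_p.+1 w = 'E_n.+1 (la z).
  by rewrite ez [RHS](E_split _ (leqW pn)).
rewrite ew in wh pD.
have eh := good_tau (IH pD) wh (tau_E z); rewrite eh in hu.
have zD : (dg ('E_n.+1 z) < D)%N.
  by apply: ltn_trans pD; rewrite !dg_iter_lcb dg_la addnS.
(* The factor c found in z brings an a to the front by cbac = acba. *)
have [v ev] := taus_Ea zD hu.
exists (lcb (la v)); rewrite ez ev -lcb_ac -E_S; congr ('E_ _ _); lia.
Qed.

Lemma step_ran m p w : (dg m <= D)%N -> (0 < p <= n.+1)%N -> m = 'E_p w -> ran m ->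
  exists u, w = 'E_(n.+1 - p) u.
Proof.
case: p => // p mD /andP[_]; rewrite ltnS subSS => pn em [_ [s [u [_ em']]]].
have e : lc (lb ('E_p w)) = iter s (@lc n) (lb ('E_n u)) by rewrite -em' em.
have wD : (dg (lc (lb ('E_p w))) <= D)%N by rewrite em in mD.
have pD : (dg ('E_p w) < D)%N by move: wD; rewrite dg_lc dg_lb; apply: ltn_trans.
have final z : 'E_p w = 'E_n z -> w = 'E_(n - p) z.
  by rewrite (E_split _ pn); apply: cancel_E; apply: ltnW.
case: s e {em'} => [|[|s]] e.
- have uD : (dg ('E_n u) < D)%N.
    by move: wD; rewrite e /= dg_lb.
  have [h [uh eh]] := @lb_inv 1 _ _ uD (esym e); rewrite /= in eh.
  have [v [_ eh']] := tau_En uD uh.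
  by exists (lcb v); apply: final; rewrite -eh' eh.
- exists u; apply: final; apply: cancel_b; last exact: cancel_c e.
  by move: wD; rewrite dg_lc; apply: ltnW.
have wu : taus s.+1 ('E_p w) ('E_n u).
  by move: e; rewrite iterS => /(cancel_c wD)/(lb_inv pD).
case: p pn em e wD pD final wu => [|p] pn em e wD pD final wu.
  by rewrite subn0; apply: taus_to_En pD wu.
case: wu => h [wh _].
have [||z ez] := dom_E pD; [by lia | by exists h |].
exists (lcb (la z)); rewrite ez -E_S; congr ('E_ _ _); lia.
Qed.

Lemma lc_eq_lb g h : (dg h < D)%N -> lc g = lb h ->
  exists h', tau h h' /\ g = lb h'.
Proof.
move=> hD e; have [[[i j]|[k g']] eg] := shapeP g; rewrite eg in e.
  by have /= := @eval_shape_inj n (inl (i.+1, j)) (inr (0%N, h)) e.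
have [h' [hh' _]] := @lb_inv k.+1 _ _ hD (esym e).
exists h'; split=> //; apply: cancel_c; last by rewrite eg e (tau_lb hh').
by rewrite eg e dg_lb.
Qed.

Lemma step_domc m g : (dg m <= D)%N -> m = lc g -> dom m -> dom g.
Proof.
move=> mD em [_ [s [u [em' _]]]]; case: s em' => [|s] em'; last first.
  rewrite (_ : g = iter s (@lc n) (lb ('E_n (la u)))); first by eexists; apply: tau_base.
  by apply: cancel_c; rewrite -?em // em'.
(* Here s = 0: m begins with both b and c, so (cb)^n au has an image, again of the form (cb)^n
   a(cbv). *)
have uD : (dg ('E_n (la u)) < D)%N by move: mD; rewrite em' /= dg_lb.
have [|h [uh ->]] := @lc_eq_lb g _ uD; first by rewrite -em em'.
by have [v [_ ->]] := tau_Ea uD uh; eexists; apply: (tau_base 0).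
Qed.

Lemma step_ranc m g : (dg m <= D)%N -> m = lc g -> ran m -> ran g.
Proof.
move=> mD em [_ [s [u [_ em']]]]; case: s em' => [|s] em'; last first.
  rewrite (_ : g = iter s (@lc n) (lb ('E_n u))); first by eexists; apply: tau_base.
  by apply: cancel_c; rewrite -?em // em'.
have uD : (dg ('E_n u) < D)%N by move: mD; rewrite em' /= dg_lb.
have [|h [uh ->]] := @lc_eq_lb g _ uD; first by rewrite -em em'.
by have [v [_ ->]] := tau_En uD uh; eexists; apply: (tau_base 0).
Qed.

(** Cancelling the smaller power of c relates the two witnesses by a chain, from which [taus_la]
    erases the a. *)
Lemma step_tau m h h' : (dg m <= D)%N -> tau m h -> tau m h' -> h = h'.
Proof.
move=> mD [s [u [em ->]]] [s' [u' [em' ->]]].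
wlog ss' : s s' u u' em em' / (s <= s')%N.
  by move=> W; have [ss'|/ltnW ss'] := leqP s s'; [|apply: esym]; apply: W.
have uD : (dg ('E_n (la u)) < D)%N.
  by move: mD; rewrite em dg_iter_lc dg_lb; apply: leq_trans; rewrite leq_addl.
move: em'; rewrite em -(subnKC ss') iterD => /cancel_iter_c e.
have {}e := lb_inv uD (e ltac:(by rewrite -em)).
by rewrite iterD -(lb_taus (taus_la uD e)).
Qed.

Lemma step_tauV m h h' : (dg m <= D)%N -> tau m h -> tau h' h -> h' = m.
Proof.
move=> mD mh h'h; have h'D : (dg h' <= D)%N by rewrite (dg_tau h'h) -(dg_tau mh).
case: mh h'h => [s [u [em eh]]] [s' [u' [em' eh']]].
wlog ss' : s s' u u' m h' em em' eh eh' mD h'D / (s <= s')%N.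
  move=> W; have [ss'|/ltnW ss'] := leqP s s'; first exact: (W s s' u u').
  by apply: esym; apply: (W s' s u' u).
have uD : (dg ('E_n (la u)) < D)%N.
  by move: mD; rewrite em dg_iter_lc dg_lb; apply: leq_trans; rewrite leq_addl.
have uD' : (dg ('E_n u) < D)%N.
  by apply: leq_ltn_trans uD; rewrite !dg_iter_lcb dg_la addnS.
move: eh'; rewrite eh -(subnKC ss') iterD => /cancel_iter_c e.
have {}e : taus (s' - s) ('E_n u) ('E_n u').
  apply: lb_inv uD' (e _); rewrite dg_iter_lc dg_lb.
  by move: mD; rewrite em !(dg_iter_lc, dg_iter_lcb, dg_lb, dg_la); lia.
by rewrite em em' -[in LHS](subnKC ss') iterD (lb_taus (taus_laV uD e)).
Qed.

Lemma good_step m : dg m = D -> good m.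
Proof.
move=> mD; have mD' : (dg m <= D)%N by rewrite mD.
split.
- by move=> x y ex ey; apply: cancel_c; rewrite -?ex.
- by move=> x y ex ey; apply: cancel_b; rewrite -?ex.
- by move=> x y ex ey; apply: cancel_a; rewrite -?ex.
- by move=> x y ex ey; apply: split_ac; rewrite -?ex.
- by move=> x y ex ey; apply: split_ab; rewrite -?ex.
- by move=> p w; apply: step_dom.
- by move=> p w; apply: step_ran.
- by move=> h h'; apply: step_tau.
- by move=> h h'; apply: step_tauV.
- by move=> g; apply: step_domc.
- by move=> g; apply: step_ranc.
Qed.

End Step.

Lemma good_all m : good m.
Proof.
have [D] := ubnP (dg m); elim: D m => // D IHD m; rewrite ltnS leq_eqVlt.
by case/predU1P=> [|/IHD //]; apply: good_step.
Qed.

End HnCancel.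

(** * Left divisors *)

Section HnDivisors.
Local Open Scope ring_scope.
Variable n : nat.
Hypothesis n_gt0 : (0 < n)%N.

Notation M := (Hn n).
Notation dg := (deg (Hn_rel n)).
Notation cls := (word_class (Hn_rel n)).
Notation "''E_' p x" := (iter p (@lcb n) x) (at level 10, p at level 8, x at level 9).

Lemma ldivP (f : M -> M) m : (forall x, f x = (f 1 * x)%g) ->
  ldiv (f 1%g) m <-> exists x, m = f x.
Proof. by move=> fM; split=> -[x ->]; exists x; [apply/esym/fM | apply: fM]. Qed.

Definition lbbBa (x : M) : M := lb (lb ('E_n (la x))).

Lemma lbbBaM x y : lbbBa (x * y)%g = (lbbBa x * y)%g.
Proof. by rewrite /lbbBa laM iter_lcbM !lbM. Qed.

(** Discharges the induction hypothesis of the step for every bound [D]. *)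
Lemma all_good D (m : M) : (dg m < D)%N -> good m.
Proof. by move=> _; apply: good_all. Qed.

(** Being a multiple of c puts g into the domain of [tau], so m = b c^s bBau = a^s bbBau; the
    alternatives are s = 0 and s > 0. *)
Lemma lc_meet_lb (m f g : M) : m = lc f -> m = lb g ->
  (exists u, m = lbbBa u) \/ (exists x, m = la x).
Proof.
move=> ef eg; rewrite ef in eg.
have [h [[s [u [eu _]]] _]] := @lc_eq_lb n n_gt0 _ (@all_good _) _ g (ltnSn _) eg.
rewrite ef eg eu lb_iter_lc; case: s {eu} => [|s]; first by left; exists u.
by right; eexists.
Qed.

(** Multiples of a and b have the form bcy, so bBau = cy; hence Bau is in the domain of [tau], and
    [tau_Ea] gives u. *)
Lemma la_meet_lbbBa (u x : M) : lbbBa u = la x -> exists v, u = lcb (la v).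
Proof.
move=> e; have [y _ /esym ey] := good_ab (good_all n_gt0 (lbbBa u)) e erefl.
have [h [uh _]] := @lc_eq_lb n n_gt0 _ (@all_good _) _ _ (ltnSn _) ey.
by have [v [-> _]] := tau_Ea n_gt0 (@all_good _) (ltnSn _) uh; exists v.
Qed.

(** With acba = cbac: bbBacbav = bb(cb)^(n+1) acv = bcb(cb)^(n+1) cv = abb(cb)^(n+1) cv. *)
Lemma lbbBa_la (v : M) : exists x, lbbBa (lcb (la v)) = la x.
Proof.
by rewrite /lbbBa -lcb_ac -E_S (tau_lb (tau_E _)) -lab; eexists.
Qed.

(* Each monomial of 1 - 3t + 2t^2 + t^(2n+3) - t^(2n+6), the expanded right-hand
   side, is carried by one element of that degree. *)
Definition divisor_coefs : seq (int * M) :=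
  [:: (1, 1%g); (-1, la 1%g); (-1, lb 1%g); (-1, lc 1%g);
      (1, la (lc 1%g)); (1, la (lb 1%g));
      (1, lbbBa 1%g); (-1, lbbBa (lcb (la 1%g)))].

Lemma sum_divisor_coefs (m : M) :
  \sum_(p <- divisor_coefs) p.1 * `[< ldiv p.2 m >]%:Z = (m == 1%g)%:Z.
Proof.
have one_div : `[< ldiv 1%g m >] = true by apply/asboolP; exists m; rewrite mul1g.
have divA := @ldivP (@la n) m (fun x => etrans (congr1 _ (esym (mul1g x))) (laM _ _)).
have divB := @ldivP (@lb n) m (fun x => etrans (congr1 _ (esym (mul1g x))) (lbM _ _)).
have divC := @ldivP (@lc n) m (fun x => etrans (congr1 _ (esym (mul1g x))) (lcM _ _)).
have divP := @ldivP lbbBa m (fun x => etrans (congr1 _ (esym (mul1g x))) (lbbBaM _ _)).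
have divAC : `[< ldiv (la (lc 1%g)) m >] = `[< ldiv (la 1%g) m >] && `[< ldiv (lc 1%g) m >].
  rewrite -asbool_and; apply: asbool_equiv_eq.
  rewrite (@ldivP (fun x => la (lc x))) => [|x]; last by rewrite -laM -lcM mul1g.
  rewrite divA divC; split=> [[x ->]|[[x ex] [y ey]]]; first by split; [|rewrite lac]; eexists.
  by have [v ev _] := good_ac (good_all n_gt0 _) ex ey; exists v; rewrite -ev.
have divAB : `[< ldiv (la (lb 1%g)) m >] = `[< ldiv (la 1%g) m >] && `[< ldiv (lb 1%g) m >].
  rewrite -asbool_and; apply: asbool_equiv_eq.
  rewrite (@ldivP (fun x => la (lb x))) => [|x]; last by rewrite -laM -lbM mul1g.
  rewrite divA divB; split=> [[x ->]|[[x ex] [y ey]]]; first by split; [|rewrite lab]; eexists.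
  by have [v ev _] := good_ab (good_all n_gt0 _) ex ey; exists v; rewrite -ev.
have divPA : `[< ldiv (lbbBa (lcb (la 1%g))) m >] = `[< ldiv (lbbBa 1%g) m >] && `[< ldiv (la 1%g) m >].
  rewrite -asbool_and; apply: asbool_equiv_eq.
  rewrite (@ldivP (fun x => lbbBa (lcb (la x)))) => [|x]; last first.
    by rewrite -lbbBaM -lcbM -laM mul1g.
  rewrite divP divA; split=> [[x ->]|[[x ex] [y ey]]].
    by split; [eexists | apply: lbbBa_la].
  by rewrite ex in ey; have [v ev] := la_meet_lbbBa ey; exists v; rewrite ex ev.
have divP_B : ldiv (lbbBa 1%g) m -> ldiv (lb 1%g) m.
  by move=> /divP[x ex]; apply/divB; rewrite ex /lbbBa; eexists.
have divP_C : ldiv (lbbBa 1%g) m -> ldiv (lc 1%g) m.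
  by move=> /divP[x ex]; apply/divC; rewrite ex /lbbBa -lcbb_rel; eexists.
have divBC : ldiv (lb 1%g) m -> ldiv (lc 1%g) m -> ldiv (lbbBa 1%g) m \/ ldiv (la 1%g) m.
  by move=> /divB[g eg] /divC[f ef]; rewrite divP divA; apply: lc_meet_lb ef eg.
rewrite !big_cons big_nil /= one_div divAC divAB divPA.
have [->{one_div divA divB divC divP divAC divAB divPA divP_B divP_C divBC}|m1] := eqVneq m 1%g.
  have nd x : (0 < dg x)%N -> `[< ldiv x (1%g : M) >] = false.
    move=> x0; apply/asboolPn => -[y /(congr1 dg)].
    by rewrite dg_one degM; [lia | apply: Hn_rel_homogeneous].
  by rewrite !nd // ?dg_la ?dg_lb ?dg_lc.
have : ldiv (la 1%g) m \/ ldiv (lb 1%g) m \/ ldiv (lc 1%g) m.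
  rewrite divA divB divC; have [[[[|i] [|j]]|[[|k] g]] em] := shapeP m.
  - by rewrite em eqxx in m1.
  - by left; rewrite em; eexists.
  - by right; right; rewrite em; eexists.
  - by right; right; rewrite em; eexists.
  - by right; left; rewrite em; eexists.
  - by right; right; rewrite em; eexists.
(* If a divides m, the terms of b, c and bbBa cancel against those of their common multiples with a.
   Otherwise bbBa divides m exactly when b and c do, and inclusion-exclusion for b and c remains. *)
case: (asboolP (ldiv (la 1%g) m)) => hA; case: (asboolP (ldiv (lb 1%g) m)) => hB;
  case: (asboolP (ldiv (lc 1%g) m)) => hC; case: (asboolP (ldiv (lbbBa 1%g) m)) => hP //=; tauto.
Qed.

Lemma finite_degree d : exists U : {fset M}, forall x, (x \in U) = (dg x <= d)%N.
Proof.
exists (seq_fset tt (flatten [seq [seq cls (tval t) | t : k.-tuple 'I_3] | k <- iota 0 d.+1])).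
move=> x; rewrite seq_fsetE; apply/flatten_mapP/idP => [[k]|xd].
  rewrite mem_iota ltnS => kd /mapP[t _ ->].
  by rewrite deg_word_class ?size_tuple //; apply: Hn_rel_homogeneous.
exists (size (repr x)); first by rewrite mem_iota ltnS.
apply/mapP; exists (in_tuple (repr x)); first by rewrite mem_enum.
by rewrite /= word_class_repr.
Qed.

Lemma generator_deg (x : M) : generators (Hn_rel n) x -> (0 < dg x)%N.
Proof. by move=> [l _ <-]; rewrite deg_word_class //; apply: Hn_rel_homogeneous. Qed.

Lemma generator_ldiv (x : M) : x <> 1%g ->
  exists2 y, generators (Hn_rel n) y & ldiv y x.
Proof.
rewrite -[x]word_class_repr; case: (repr x) => [|l w] // _.
by exists (cls [:: l]); [exists l | exists (cls w); rewrite -cls_cat].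
Qed.

End HnDivisors.

Local Open Scope ring_scope.

Theorem mainTheorem3 (n : nat) (hn : (1 <= n)%N) :
  skew_growth (M := Hn n) (generators (Hn_rel n)) (deg (Hn_rel n)) =
  poly_series ((1 - 'X) * ('X^(2 * n + 5) + 'X^(2 * n + 4) + 'X^(2 * n + 3)
                           - 2 * 'X + 1)).
Proof.
apply/funext => d.
rewrite (skew_growth_ldiv _ _ (finite_degree n) _ (generator_ldiv (n := n)) (sum_divisor_coefs hn)).
(* The product is expanded in the order of [divisor_coefs]. *)
- have -> : (1 - 'X) * ('X^(2 * n + 5) + 'X^(2 * n + 4) + 'X^(2 * n + 3) - 2 * 'X + 1) =
      1 - 'X - 'X - 'X + 'X^2 + 'X^2 + 'X^(2 * n + 3) - 'X^(2 * n + 6) :> {poly int}.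
    by rewrite !exprD; ring.
  rewrite /poly_series !(coefD, coefN, coefXn, coefX, coef1) !big_cons big_nil /=.
  rewrite !(dg_one, dg_la, dg_lb, dg_lc, dg_lcb, dg_iter_lcb) !(eq_sym _ d).
  (* The degrees of bbBa and bbBacba. *)
  have -> : ((n.*2 + 1).+2 = 2 * n + 3)%N by lia.
  have -> : ((n.*2 + 4).+2 = 2 * n + 6)%N by lia.
  by rewrite !natz; ring.
- by move=> x y; apply/degM/Hn_rel_homogeneous.
- by move=> x /size0nil x0; rewrite -[x]word_class_repr x0.
- exact: generator_deg.
Qed.
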